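(* Consider the system $$N'(t)+a(t)N(t)=\sum_{i=1}^n b_i(t)e^{-\beta_i(t)N(t-m_i\omega)}\quad(0\le t\ne t_k),\qquad \Delta N(t_k):=N(t_k^+)-N(t_k)=b_kN(t_k)\quad(k=1,2,\dots),\tag{L}$$ in the setting described in the context, with $b_k>-1$ for all $k$, $t_{k+p}=t_k+\omega$ and $b_{k+p}=b_k$ for all $k\in\mathbb{N}$, and $\prod_{k=1}^p(1+b_k)\le1$; denote $\bar m=\max_{1\le i\le n}m_i$. Let $N^*(t)$ be an $\omega$-periodic positive solution of (L). If $$\sigma:=\Big(\overline{\beta N^*}\,(e^{\overline{\beta N^*}}-1)\Big)^{1/2}\left[1-\Big(e^{-\int_0^\omega a(u)\,du}\prod_{k=1}^p(1+b_k)\Big)^{\bar m}\right]<1,$$ then $\lim_{t\to\infty}(N(t)-N^*(t))=0$ for any positive solution $N(t)$ of (L).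
   Context: Setting. $\omega>0$ and $n,p,m_1,\dots,m_n$ are positive integers. The functions $a,b_i,\beta_i:\mathbb{R}\to(0,\infty)$, $1\le i\le n$, are continuous, positive and $\omega$-periodic (the coefficient functions $b_i(t)$ are not to be confused with the impulse constants $b_k$). $0<t_1<t_2<\cdots<t_p<\omega$ and $t_k\to\infty$. Solutions are left continuous and $N'(t)$ is the left-hand derivative. Notation: $\overline{\beta N^*}=\max_{0\le t\le\omega}\max_{1\le i\le n}\beta_i(t)N^*(t)$ (supremum if not attained). Positive solutions of (L) are the solutions with initial condition $N(\theta)=\phi(\theta)$ on $[-\bar m\omega,0]$, where $\phi:[-\bar m\omega,0]\to[0,\infty)$ is continuous with $\phi(0)>0$. *)

(* Defs.v *)
From Stdlib Require Import Reals List.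
From Coquelicot Require Import Coquelicot.
Open Scope R_scope.

(* Finite families are indexed from 1: [tau k] and [bk k] (impulse times and
   impulse constants) are meaningful for k >= 1, and [m i], [b i], [beta i]
   for 1 <= i <= n.  The values at index 0 are never used. *)

Definition periodic (omega : R) (f : R -> R) : Prop :=
  forall t : R, f (t + omega) = f t.

Definition prod1 (p : nat) (f : nat -> R) : R :=
  fold_right Rmult 1 (map f (seq 1 p)).

Definition mbar (n : nat) (m : nat -> nat) : nat :=
  list_max (map m (seq 1 n)).

Definition is_left_derive (f : R -> R) (t l : R) : Prop :=
  filterlim (fun s => (f s - f t) / (s - t)) (at_left t) (locally l).

Definition impulse_time (tau : nat -> R) (t : R) : Prop :=
  exists k : nat, (1 <= k)%nat /\ t = tau k.

(* A solution is piecewise continuous on [0, +oo), with jumps only at the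
   impulse times.  At t = 0 the left-hand derivative would only involve the
   initial function, so the differential equation is imposed for t > 0.
   Values before -(mbar * omega) are irrelevant. *)
Record is_solution (omega : R) (n : nat) (m : nat -> nat)
    (a : R -> R) (b beta : nat -> R -> R) (tau bk : nat -> R)
    (N : R -> R) : Prop := {
  sol_continuous : forall t : R, 0 <= t -> ~ impulse_time tau t ->
    filterlim N (within (fun s => 0 <= s) (locally t)) (locally (N t));
  sol_left_continuous : forall k : nat, (1 <= k)%nat ->
    filterlim N (at_left (tau k)) (locally (N (tau k)));
  sol_equation : forall t : R, 0 < t -> ~ impulse_time tau t ->
    exists dN : R, is_left_derive N t dN /\
      dN + a t * N t =
        sum_n_m (fun i => b i t * exp (- beta i t * N (t - INR (m i) * omega)))
          1 n;
  sol_jump : forall k : nat, (1 <= k)%nat ->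
    exists Nplus : R,
      filterlim N (at_right (tau k)) (locally Nplus) /\
      Nplus - N (tau k) = bk k * N (tau k)
}.

Definition is_positive_solution (omega : R) (n : nat) (m : nat -> nat)
    (a : R -> R) (b beta : nat -> R -> R) (tau bk : nat -> R)
    (N : R -> R) : Prop :=
  is_solution omega n m a b beta tau bk N /\
  exists phi : R -> R,
    let I := fun theta => - (INR (mbar n m) * omega) <= theta <= 0 in
    continuous_on I phi /\
    (forall theta : R, I theta -> 0 <= phi theta) /\
    0 < phi 0 /\
    (forall theta : R, I theta -> N theta = phi theta).

(* A periodic solution lives on [-(mbar * omega), +oo).  Its restriction to
   [-(mbar * omega), 0] inherits the jumps by periodicity, so it is not
   required to have a continuous initial function. *)
Definition is_periodic_positive_solution (omega : R) (n : nat) (m : nat -> nat)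
    (a : R -> R) (b beta : nat -> R -> R) (tau bk : nat -> R)
    (N : R -> R) : Prop :=
  is_solution omega n m a b beta tau bk N /\
  (forall t : R, - (INR (mbar n m) * omega) <= t ->
     0 < N t /\ N (t + omega) = N t).

(* The set is nonempty and bounded for a piecewise continuous N, so that the
   supremum in Rbar is finite. *)
Definition beta_sup (omega : R) (n : nat) (beta : nat -> R -> R)
    (N : R -> R) : R :=
  real (Lub_Rbar (fun x => exists (t : R) (i : nat),
    0 <= t <= omega /\ (1 <= i <= n)%nat /\ x = beta i t * N t)).

Definition sigma_const (omega : R) (n p : nat) (m : nat -> nat)
    (a : R -> R) (beta : nat -> R -> R) (bk : nat -> R) (Nstar : R -> R) : R :=
  let M := beta_sup omega n beta Nstar in
  sqrt (M * (exp M - 1)) *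
  (1 - (exp (- RInt a 0 omega) * prod1 p (fun k => 1 + bk k)) ^ mbar n m).

(* Main.v *)
Require Import Defs.
From Stdlib Require Import Reals List Lra Lia Classical.
From Coquelicot Require Import Coquelicot.
Open Scope R_scope.

(** Since the delays are multiples of the period, the relative deviation
    [y = N / Nstar - 1] satisfies, with [c_i = beta_i * Nstar] and
    nonnegative weights [g_i] of sum [g],
      [y' = - g y + sum_i g_i (exp (- c_i * y (t - m_i * omega)) - 1)],
    and [y] is continuous because [N] and [Nstar] have the same jump ratios.
    Moreover [g] is the logarithmic derivative of [E = w * Nstar], where the
    weight [w] is the integrating factor of the homogeneous impulsive
    equation ([weight]); hence [E] is increasing and a shift by the largest
    delay divides it by [kappa], the power [mbar] of
    [exp (- int a) * prod (1 + b_k)].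

    The feedback is negative, so a deviation of one sign can only build up
    from a zero of [y] during one delay.  If [- l <= y] for late times, then
    the delayed terms are at most [exp (M * l) - 1 <= l * (exp M - 1)], where
    [M] bounds all [c_i], and building up from a zero over one delay yields
    only the fraction [1 - kappa] of this:
    [y <= (1 - kappa) * (exp M - 1) * l] eventually ([upper_from_lower]).
    In the same way [y <= L] implies [- y <= (1 - kappa) * M * L] eventually
    ([lower_from_upper]).  One round trip multiplies [l] by [sigma ^ 2 < 1],
    and the iteration starts with [l = 1] because [N] is nonnegative.  So [y]
    tends to 0, and so does [N - Nstar = y * Nstar], as [Nstar] is bounded.

    The functions [w * N] and [E] are continuous, and the derivative of
    [w * N] consists of the birth terms only.  The estimates are therefore
    carried out on [w * (N - Nstar) = y * E] instead of [y]: an inequality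
    [y' <= g (P - y)] says that [y * E - P * E] is nonincreasing
    ([weighted_combination_nonincreasing]).  The argument with the last zero
    is [eventually_bounded_above]. *)

(** * Monotonicity from left-hand derivatives *)

Lemma continuous_on_eps (D : R -> Prop) (f : R -> R) (x eps : R) :
  continuous_on D f -> D x -> 0 < eps ->
  exists delta, 0 < delta /\
    forall s, D s -> Rabs (s - x) < delta -> Rabs (f s - f x) < eps.
Proof.
  intros Hf Hx He.
  destruct (proj1 (filterlim_locally _ _) (Hf x Hx) (mkposreal eps He))
    as [delta Hd].
  exists delta; split; [apply cond_pos|].
  intros s Hs Hsx. exact (Hd s Hsx Hs).
Qed.

Lemma left_derive_nonpos_eps (f : R -> R) (t l eps : R) :
  is_left_derive f t l -> l <= 0 -> 0 < eps ->
  exists delta, 0 < delta /\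
    forall s, t - delta < s < t -> f t <= f s + eps * (t - s).
Proof.
  intros Hf Hl He.
  destruct (proj1 (filterlim_locally _ _) Hf (mkposreal eps He)) as [delta Hd].
  exists delta; split; [apply cond_pos|].
  intros s [Hs1 Hs2].
  assert (H : Rabs ((f s - f t) / (s - t) - l) < eps).
  { apply (Hd s); [|lra].
    unfold ball; simpl; unfold AbsRing_ball, abs, minus, plus, opp; simpl.
    apply Rabs_def1; lra. }
  apply Rabs_def2 in H.
  assert (E : f s - f t = (f s - f t) / (s - t) * (s - t)) by (field; lra).
  assert ((f s - f t) / (s - t) * (s - t) >= eps * (s - t)) by nra.
  lra.
Qed.

(** Only the left-hand derivative is controlled, so the mean value theorem
    does not apply.  Instead, go leftwards from [d]: the infimum [x] of the
    points [s] with [f d <= f s + eps * (d - s) + eps] is such a point by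
    continuity, and if [c < x] then the sign of the left-hand derivative at
    [x] yields a smaller one. *)
Lemma left_derive_nonincreasing (f : R -> R) (c d : R) :
  c <= d -> continuous_on (fun s => c <= s <= d) f ->
  (forall t, c < t < d -> exists l, is_left_derive f t l /\ l <= 0) ->
  f d <= f c.
Proof.
  intros Hcd Hf Hl.
  destruct (Req_dec c d) as [->|Hne]; [lra|].
  apply le_epsilon. intros e He.
  set (eps := e / (d - c + 1)).
  assert (Heps : 0 < eps) by (apply Rdiv_lt_0_compat; lra).
  assert (Hee : eps * (d - c + 1) = e) by (unfold eps; field; lra).
  (* [completeness] provides suprema, hence the reflection
     of the set of good points through 0. *)
  set (S := fun x => c <= - x <= d /\ f d <= f (- x) + eps * (d + x) + eps).
  (* The extra [eps] in S makes points just below d good, so that the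
     infimum differs from d, where no derivative is assumed. *)
  destruct (continuous_on_eps _ f d eps Hf ltac:(lra) Heps) as [dl [Hdl Hd]].
  set (s0 := Rmax c (d - dl / 2)).
  assert (Hs0 : c <= s0 < d /\ Rabs (s0 - d) < dl).
  { unfold s0, Rmax; destruct (Rle_dec c (d - dl / 2)); split; try lra;
    apply Rabs_def1; lra. }
  assert (HS0 : S (- s0)).
  { unfold S. rewrite Ropp_involutive.
    specialize (Hd s0 ltac:(lra) (proj2 Hs0)). apply Rabs_def2 in Hd.
    split; [lra|]. nra. }
  destruct (completeness S) as [y [Hub Hlub]].
  { exists (- c). intros x [Hx _]; lra. }
  { exists (- s0); exact HS0. }
  set (x := - y).
  assert (Hxs : x <= s0) by (specialize (Hub _ HS0); unfold x; lra).
  assert (Hcx : c <= x).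
  { assert (y <= - c); [|unfold x; lra]. apply Hlub. intros u [Hu _]; lra. }
  assert (Happ : forall r, 0 < r -> exists s, S (- s) /\ x <= s < x + r).
  { intros r Hr. apply NNPP. intro Hn.
    assert (y <= y - r); [|lra]. apply Hlub. intros u Hu.
    destruct (Rle_dec u (y - r)) as [|Hu']; [assumption|]. exfalso; apply Hn.
    exists (- u). rewrite Ropp_involutive. split; [exact Hu|].
    specialize (Hub u Hu). unfold x; lra. }
  assert (HSx : f d <= f x + eps * (d - x) + eps).
  { apply le_epsilon. intros r Hr.
    destruct (continuous_on_eps _ f x r Hf ltac:(lra) Hr) as [dx [Hdx Hx]].
    destruct (Happ dx Hdx) as [s [[Hs1 Hs2] Hs3]].
    rewrite Ropp_involutive in Hs1, Hs2.
    specialize (Hx s Hs1 ltac:(apply Rabs_def1; lra)). apply Rabs_def2 in Hx.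
    nra. }
  destruct (Req_dec c x) as [Heq|Hcx'].
  { rewrite <- Heq in HSx. lra. }
  exfalso.
  destruct (Hl x ltac:(lra)) as [l [Hl1 Hl2]].
  destruct (left_derive_nonpos_eps f x l eps Hl1 Hl2 Heps) as [dx [Hdx Hx]].
  set (s := Rmax c (x - dx / 2)).
  assert (Hs : c <= s < x /\ x - dx < s).
  { unfold s, Rmax; destruct (Rle_dec c (x - dx / 2)); lra. }
  assert (HS : S (- s)).
  { unfold S. rewrite Ropp_involutive. split; [lra|].
    specialize (Hx s ltac:(lra)). lra. }
  specialize (Hub _ HS). unfold x in Hs; lra.
Qed.

(** Cutting at an exceptional point makes it an endpoint of both pieces, and
    endpoints need continuity only. *)
Lemma left_derive_nonincreasing_except (l : list R) (f : R -> R) (c d : R) :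
  c <= d -> continuous_on (fun s => c <= s <= d) f ->
  (forall t, c < t < d -> ~ In t l ->
     exists dl, is_left_derive f t dl /\ dl <= 0) ->
  f d <= f c.
Proof.
  revert c d. induction l as [|x l IH]; intros c d Hcd Hf Hl.
  - apply left_derive_nonincreasing; auto.
  - destruct (Rlt_dec c x) as [H1|H1]; [destruct (Rlt_dec x d) as [H2|H2]|].
    + apply Rle_trans with (f x).
      * apply IH; [lra| |].
        { apply continuous_on_subset with (2 := Hf); intros; lra. }
        { intros t Ht Hn. apply Hl; [lra|]. intros [E|E]; [lra|auto]. }
      * apply IH; [lra| |].
        { apply continuous_on_subset with (2 := Hf); intros; lra. }
        { intros t Ht Hn. apply Hl; [lra|]. intros [E|E]; [lra|auto]. }
    + apply IH; auto. intros t Ht Hn. apply Hl; auto. intros [E|E]; [lra|auto].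
    + apply IH; auto. intros t Ht Hn. apply Hl; auto. intros [E|E]; [lra|auto].
Qed.

(** * One-sided bounds under negative feedback *)

Lemma last_nonpositive (f : R -> R) (c d : R) :
  c <= d -> continuous_on (fun s => c <= s <= d) f -> f c <= 0 ->
  exists x, c <= x <= d /\ f x <= 0 /\ forall s, x < s <= d -> 0 < f s.
Proof.
  intros Hcd Hf Hc.
  destruct (completeness (fun x => c <= x <= d /\ f x <= 0)) as [x [Hub Hlub]].
  { exists d. intros u [Hu _]; lra. }
  { exists c; split; lra. }
  assert (Hcx : c <= x) by (apply Hub; split; lra).
  assert (Hxd : x <= d) by (apply Hlub; intros u [Hu _]; lra).
  exists x. repeat split; try assumption.
  - apply le_epsilon. intros r Hr.
    destruct (continuous_on_eps _ f x r Hf ltac:(lra) Hr) as [dx [Hdx Hx]].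
    apply NNPP. intro Hn.
    assert (x <= x - dx); [|lra]. apply Hlub. intros u [Hu1 Hu2].
    destruct (Rle_dec u (x - dx)) as [|Hu']; [assumption|].
    exfalso; apply Hn.
    assert (u <= x) by (apply Hub; split; lra).
    specialize (Hx u Hu1 ltac:(apply Rabs_def1; lra)). apply Rabs_def2 in Hx.
    lra.
  - intros s Hs. apply Rnot_le_lt. intro Hn.
    assert (s <= x); [|lra]. apply Hub; split; lra.
Qed.

(** The oscillation argument behind the theorem, for the quotient [D / E]
    measured on the increasing clock [E], whose value is multiplied by
    [/ kappa] after each delay [r].

    If [D] is not positive at some late time, consider a later [t] with
    [0 < D t] and the last zero [x] before [t].  Until [x + r] the growth
    bound started at [x] gives
    [D t <= P * (E t - E x) <= (1 - kappa) * P * E t], because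
    [kappa * E t <= E x]; after [x + r] the whole delay window lies where
    [D] is nonnegative, so [D] no longer grows.  If instead [D] stays
    positive, it is eventually nonincreasing while [E] grows geometrically,
    and any positive multiple of [E] overtakes it. *)
Lemma eventually_bounded_above (E D : R -> R) (r kappa P T : R) :
  0 < r -> 0 < kappa < 1 -> 0 < P -> 0 <= T ->
  (forall t, 0 <= t -> 0 < E t) ->
  (forall s t, 0 <= s <= t -> E s <= E t) ->
  (forall t, 0 <= t -> E t = kappa * E (t + r)) ->
  continuous_on (fun s => 0 <= s) D ->
  (forall s t, T <= s <= t -> D t - D s <= P * (E t - E s)) ->
  (forall s t, T + r <= s <= t -> (forall u, s - r < u <= t -> 0 <= D u) ->
     D t <= D s) ->
  exists T', 0 <= T' /\ forall t, T' <= t -> D t <= (1 - kappa) * P * E t.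
Proof.
  intros Hr Hk HP HT HE Hmon Hper HD H1 H2.
  destruct (classic (exists xi, T <= xi /\ D xi <= 0)) as [[xi [Hxi HDxi]]|Hpos].
  - exists xi. split; [lra|]. intros t Ht.
    destruct (last_nonpositive D xi t Ht) as [x [Hx [HDx Hlast]]];
      [apply continuous_on_subset with (2 := HD); intros; lra|assumption|].
    assert (Hcross : forall s, x <= s <= t -> s <= x + r ->
              D s <= (1 - kappa) * P * E s).
    { intros s Hs Hsr.
      assert (A := H1 x s ltac:(lra)).
      assert (B := Hmon s (x + r) ltac:(lra)).
      assert (C := Hper x ltac:(lra)).
      assert (kappa * E s <= E x) by (rewrite C; nra).
      nra. }
    destruct (Rle_dec t (x + r)) as [Htr|Htr]; [apply Hcross; lra|].
    apply Rle_trans with (D (x + r)).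
    + apply H2; [lra|]. intros u Hu. apply Rlt_le, Hlast; lra.
    + assert (A := Hcross (x + r) ltac:(lra) ltac:(lra)).
      assert (B := Hmon (x + r) t ltac:(lra)).
      assert (0 < (1 - kappa) * P) by (apply Rmult_lt_0_compat; lra).
      nra.
  - assert (Hp : forall t, T <= t -> 0 < D t).
    { intros t Ht. apply Rnot_le_lt. intro Hn. apply Hpos. exists t; auto. }
    set (T0 := T + r).
    assert (Hdec : forall t, T0 <= t -> D t <= D T0).
    { intros t Ht. apply H2; [unfold T0 in *; lra|].
      intros u Hu. apply Rlt_le, Hp. unfold T0 in *; lra. }
    assert (HEk : forall k, kappa ^ k * E (T0 + INR k * r) = E T0).
    { induction k as [|k IH]; [simpl; rewrite Rmult_0_l, Rplus_0_r; ring|].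
      rewrite <- IH, (Hper (T0 + INR k * r)), S_INR.
      - simpl. replace (T0 + (INR k + 1) * r) with (T0 + INR k * r + r) by ring.
        ring.
      - assert (0 <= INR k * r) by (apply Rmult_le_pos; [apply pos_INR|lra]).
        unfold T0; lra. }
    assert (HD0 : 0 < D T0) by (apply Hp; unfold T0; lra).
    assert (HE0 : 0 < E T0) by (apply HE; unfold T0; lra).
    set (Q := (1 - kappa) * P).
    assert (HQ : 0 < Q) by (apply Rmult_lt_0_compat; lra).
    assert (Hy : 0 < Q * E T0 / D T0)
      by (apply Rdiv_lt_0_compat; [apply Rmult_lt_0_compat|]; lra).
    destruct (pow_lt_1_zero kappa ltac:(apply Rabs_def1; lra) _ Hy) as [k Hkk].
    specialize (Hkk k (le_n k)).
    exists (T0 + INR k * r).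
    assert (Hkr : 0 <= INR k * r)
      by (apply Rmult_le_pos; [apply pos_INR|lra]).
    split; [unfold T0; lra|]. intros t Ht.
    apply Rle_trans with (D T0); [apply Hdec; lra|].
    assert (B := Hmon (T0 + INR k * r) t ltac:(unfold T0 in *; lra)).
    assert (0 < kappa ^ k) by (apply pow_lt; lra).
    rewrite Rabs_pos_eq in Hkk by lra.
    assert (Hkk' : kappa ^ k * D T0 <= Q * E T0).
    { apply Rlt_le. apply Rmult_lt_compat_r with (r := D T0) in Hkk; [|lra].
      replace (Q * E T0 / D T0 * D T0) with (Q * E T0) in Hkk by (field; lra).
      exact Hkk. }
    rewrite <- (HEk k) in Hkk'.
    assert (D T0 <= Q * E (T0 + INR k * r)).
    { apply Rmult_le_reg_l with (kappa ^ k); [lra|]. nra. }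
    nra.
Qed.

(** * Finite products and the product of the jump ratios *)

Lemma prod1_S (k : nat) (f : nat -> R) : prod1 (S k) f = prod1 k f * f (S k).
Proof.
  unfold prod1. rewrite seq_S, map_app, fold_right_app. simpl.
  generalize (map f (seq 1 k)). intro l. rewrite Rmult_1_r.
  induction l as [|x l IH]; simpl; [ring|]. rewrite IH; ring.
Qed.

Lemma prod1_ext (k : nat) (f g : nat -> R) :
  (forall j, (1 <= j <= k)%nat -> f j = g j) -> prod1 k f = prod1 k g.
Proof.
  induction k as [|k IH]; intros H; [reflexivity|].
  rewrite !prod1_S, IH, H; auto; try lia. intros; apply H; lia.
Qed.

Lemma prod1_pos (k : nat) (f : nat -> R) :
  (forall j, (1 <= j <= k)%nat -> 0 < f j) -> 0 < prod1 k f.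
Proof.
  induction k as [|k IH]; intros H; [unfold prod1; simpl; lra|].
  rewrite prod1_S. apply Rmult_lt_0_compat; [apply IH; intros|]; apply H; lia.
Qed.

Lemma prod1_le (k : nat) (f g : nat -> R) :
  (forall j, (1 <= j <= k)%nat -> 0 < f j <= g j) -> prod1 k f <= prod1 k g.
Proof.
  induction k as [|k IH]; intros H; [unfold prod1; simpl; lra|].
  rewrite !prod1_S. apply Rmult_le_compat.
  - apply Rlt_le, prod1_pos. intros; apply H; lia.
  - apply Rlt_le, H; lia.
  - apply IH; intros; apply H; lia.
  - apply H; lia.
Qed.

Lemma prod1_add (p k : nat) (f : nat -> R) :
  prod1 (p + k) f = prod1 p f * prod1 k (fun j => f (j + p)%nat).
Proof.
  induction k as [|k IH].
  - rewrite Nat.add_0_r. unfold prod1 at 3. simpl. ring.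
  - rewrite Nat.add_succ_r, !prod1_S, IH, Rmult_assoc. do 3 f_equal. lia.
Qed.

Lemma prod1_trailing_ones (j k : nat) (f : nat -> R) :
  (j <= k)%nat -> (forall i, (j < i)%nat -> f i = 1) -> prod1 k f = prod1 j f.
Proof.
  intros Hjk H. induction Hjk as [|k Hjk IH]; [reflexivity|].
  rewrite prod1_S, IH, H; [ring|lia].
Qed.

Lemma prod1_update (k j : nat) (x : R) (f : nat -> R) :
  (1 <= j <= k)%nat -> f j = 1 ->
  prod1 k (fun i => if Nat.eq_dec i j then x else f i) = x * prod1 k f.
Proof.
  induction k as [|k IH]; intros Hj Hf; [lia|].
  rewrite !prod1_S. destruct (Nat.eq_dec (S k) j) as [E|E].
  - subst j. rewrite Hf, (prod1_ext k _ f); [ring|].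
    intros i Hi. destruct (Nat.eq_dec i (S k)); [lia|reflexivity].
  - rewrite IH; [ring|lia|assumption].
Qed.

Definition jump_factor (tau bk : nat -> R) (t : R) (k : nat) : R :=
  if Rlt_dec (tau k) t then 1 + bk k else 1.

(** By periodicity the impulses that occur up to time [t] all have index at
    most [j * p] when [t <= j * omega]. *)
Definition impulse_bound (omega : R) (p : nat) (t : R) : nat :=
  (Z.to_nat (up (t / omega)) * p)%nat.

(** The product of [1 + b_k] over the impulses [t_k < t]; the strict
    inequality makes it left continuous, like the solutions. *)
Definition jump_product (omega : R) (p : nat) (tau bk : nat -> R) (t : R) : R :=
  prod1 (impulse_bound omega p t) (jump_factor tau bk t).

Section Impulses.

Variables (omega : R) (p : nat) (tau bk : nat -> R).
Hypothesis omega_pos : 0 < omega.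
Hypothesis p_pos : (1 <= p)%nat.
Hypothesis tau_first : 0 < tau 1%nat.
Hypothesis tau_incr : forall k : nat, (1 <= k < p)%nat -> tau k < tau (S k).
Hypothesis tau_last : tau p < omega.
Hypothesis tau_per :
  forall k : nat, (1 <= k)%nat -> tau (k + p)%nat = tau k + omega.
Hypothesis bk_gt : forall k : nat, (1 <= k)%nat -> - 1 < bk k.
Hypothesis bk_per : forall k : nat, (1 <= k)%nat -> bk (k + p)%nat = bk k.

Lemma tau_lt_succ (k : nat) : (1 <= k)%nat -> tau k < tau (S k).
Proof.
  induction k as [k IH] using (well_founded_induction Nat.lt_wf_0). intros Hk.
  destruct (Nat.lt_ge_cases k p) as [H|H]; [apply tau_incr; lia|].
  destruct (Nat.eq_dec k p) as [->|Hne].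
  - replace (S p) with (1 + p)%nat by lia. rewrite tau_per by lia. lra.
  - replace (S k) with (S (k - p) + p)%nat by lia.
    replace k with ((k - p) + p)%nat at 1 by lia.
    rewrite !tau_per by lia. specialize (IH (k - p)%nat ltac:(lia) ltac:(lia)).
    lra.
Qed.

Lemma tau_lt (j k : nat) : (1 <= j < k)%nat -> tau j < tau k.
Proof.
  intros [Hj Hjk]. induction Hjk as [|k Hjk IH]; [apply tau_lt_succ; lia|].
  apply Rlt_trans with (1 := IH). apply tau_lt_succ; lia.
Qed.

Lemma tau_inj (j k : nat) :
  (1 <= j)%nat -> (1 <= k)%nat -> tau j = tau k -> j = k.
Proof.
  intros Hj Hk E. destruct (Nat.lt_total j k) as [H|[H|H]]; [|assumption|].
  - assert (A := tau_lt j k ltac:(lia)). lra.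
  - assert (A := tau_lt k j ltac:(lia)). lra.
Qed.

Lemma tau_pos (k : nat) : (1 <= k)%nat -> 0 < tau k.
Proof.
  intros Hk. destruct (Nat.eq_dec k 1) as [->|H]; [assumption|].
  assert (A := tau_lt 1 k ltac:(lia)). lra.
Qed.

Lemma tau_gt_periods (j k : nat) : (j * p < k)%nat -> INR j * omega < tau k.
Proof.
  revert k. induction j as [|j IH]; intros k Hk.
  - simpl. rewrite Rmult_0_l. apply tau_pos; lia.
  - replace k with ((k - p) + p)%nat by nia. rewrite tau_per by nia.
    rewrite S_INR. specialize (IH (k - p)%nat ltac:(nia)). lra.
Qed.

Lemma tau_gt_bound (t : R) (k : nat) :
  (impulse_bound omega p t < k)%nat -> t < tau k.
Proof.
  intros Hk. apply tau_gt_periods in Hk.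
  apply Rle_lt_trans with (2 := Hk).
  destruct (archimed (t / omega)) as [A _].
  assert (IZR (up (t / omega)) <= INR (Z.to_nat (up (t / omega)))).
  { rewrite INR_IZR_INZ. apply IZR_le. lia. }
  replace t with (t / omega * omega) at 1 by (field; lra).
  apply Rmult_le_compat_r; lra.
Qed.

Lemma impulse_times_finite (d : R) :
  forall t, t <= d ->
    ~ In t (map tau (seq 1 (impulse_bound omega p d))) ->
    ~ impulse_time tau t.
Proof.
  intros t Ht Hn [k [Hk E]].
  destruct (Nat.lt_ge_cases (impulse_bound omega p d) k) as [H|H].
  - apply tau_gt_bound in H. lra.
  - apply Hn. rewrite E. apply in_map, in_seq. lia.
Qed.

Lemma jump_factor_pos (t : R) (k : nat) :
  (1 <= k)%nat -> 0 < jump_factor tau bk t k.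
Proof.
  intros Hk. unfold jump_factor. specialize (bk_gt k Hk).
  destruct (Rlt_dec (tau k) t); lra.
Qed.

Lemma jump_product_eq (k : nat) (t : R) :
  (forall i, (k < i)%nat -> t <= tau i) ->
  jump_product omega p tau bk t = prod1 k (jump_factor tau bk t).
Proof.
  intros H. unfold jump_product. set (b := impulse_bound omega p t).
  rewrite <- (prod1_trailing_ones b (Nat.max b k)); [|lia|].
  - apply prod1_trailing_ones; [lia|]. intros i Hi. unfold jump_factor.
    destruct (Rlt_dec (tau i) t) as [A|A]; [|reflexivity].
    specialize (H i Hi). lra.
  - intros i Hi. apply tau_gt_bound in Hi. unfold jump_factor.
    destruct (Rlt_dec (tau i) t); [lra|reflexivity].
Qed.

Lemma jump_product_pos (t : R) : 0 < jump_product omega p tau bk t.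
Proof. apply prod1_pos. intros; apply jump_factor_pos; lia. Qed.

(** Near a given [t] only finitely many impulses matter, so a property of
    the individual factors that holds along a filter passes to their
    product.  It is used for neighbourhoods and for one-sided
    neighbourhoods. *)
Lemma jump_product_filter (F : (R -> Prop) -> Prop) (FF : Filter F)
    (g : nat -> R) (t : R) :
  F (fun s => s <= t + 1) ->
  (forall k, (1 <= k)%nat -> F (fun s => jump_factor tau bk s k = g k)) ->
  F (fun s => jump_product omega p tau bk s =
                prod1 (impulse_bound omega p (t + 1)) g).
Proof.
  intros Ht Hg. set (b := impulse_bound omega p (t + 1)).
  assert (A : forall k,
    F (fun s => prod1 k (jump_factor tau bk s) = prod1 k g)).
  { induction k as [|k IH].
    - apply filter_forall. reflexivity.
    - generalize (filter_and _ _ IH (Hg (S k) ltac:(lia))).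
      apply filter_imp. intros s [H1 H2]. rewrite !prod1_S, H1, H2. reflexivity. }
  generalize (filter_and _ _ Ht (A b)). apply filter_imp. intros s [H1 H2].
  rewrite <- H2. apply jump_product_eq. intros i Hi.
  apply tau_gt_bound in Hi. lra.
Qed.

Lemma jump_product_prod1 (t : R) :
  jump_product omega p tau bk t =
    prod1 (impulse_bound omega p (t + 1)) (jump_factor tau bk t).
Proof.
  apply jump_product_eq. intros i Hi. apply tau_gt_bound in Hi. lra.
Qed.

Lemma locally_le_plus_1 (t : R) : locally t (fun s => s <= t + 1).
Proof.
  exists (mkposreal 1 Rlt_0_1). intros s Hs. apply Rabs_def2 in Hs.
  unfold minus, plus, opp in Hs; simpl in Hs. lra.
Qed.

Lemma jump_product_locally_constant (t : R) :
  ~ impulse_time tau t ->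
  locally t (fun s => jump_product omega p tau bk s =
                      jump_product omega p tau bk t).
Proof.
  intros Ht. rewrite jump_product_prod1.
  apply jump_product_filter; [apply _|apply locally_le_plus_1|].
  intros k Hk. unfold jump_factor.
  destruct (Rlt_dec (tau k) t) as [H|H].
  - generalize (open_gt (tau k) t H). apply filter_imp. intros s Hs.
    destruct (Rlt_dec (tau k) s); [reflexivity|lra].
  - assert (H' : t < tau k).
    { destruct (Req_dec t (tau k)) as [E|E]; [|lra].
      exfalso; apply Ht; exists k; auto. }
    generalize (open_lt (tau k) t H'). apply filter_imp. intros s Hs.
    destruct (Rlt_dec (tau k) s); [lra|reflexivity].
Qed.

Lemma jump_product_at_left (t : R) :
  at_left t (fun s => jump_product omega p tau bk s =
                      jump_product omega p tau bk t).
Proof.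
  rewrite jump_product_prod1. apply jump_product_filter; [apply _| |].
  { unfold at_left, within. generalize (locally_le_plus_1 t).
    apply filter_imp. auto. }
  intros k Hk. unfold jump_factor.
  destruct (Rlt_dec (tau k) t) as [H|H].
  - unfold at_left, within. generalize (open_gt (tau k) t H). apply filter_imp. intros s Hs _.
    destruct (Rlt_dec (tau k) s); [reflexivity|lra].
  - unfold at_left, within. apply filter_forall. intros s Hs.
    destruct (Rlt_dec (tau k) s); [lra|reflexivity].
Qed.

(** Crossing [t_j] switches on the [j]-th factor and no other one, since the
    impulse times are distinct.  This is the jump ratio of the solutions,
    which is why dividing by the product makes them continuous. *)
Lemma jump_product_at_right (j : nat) :
  (1 <= j)%nat ->
  at_right (tau j) (fun s => jump_product omega p tau bk s =
                      (1 + bk j) * jump_product omega p tau bk (tau j)).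
Proof.
  intros Hj. rewrite jump_product_prod1.
  rewrite <- (prod1_update _ j).
  2: { split; [assumption|].
       destruct (Nat.lt_ge_cases (impulse_bound omega p (tau j + 1)) j)
         as [H|H]; [|assumption].
       apply tau_gt_bound in H. lra. }
  2: { unfold jump_factor. destruct (Rlt_dec (tau j) (tau j)); [lra|reflexivity]. }
  apply jump_product_filter; [apply _| |].
  { unfold at_right, within. generalize (locally_le_plus_1 (tau j)).
    apply filter_imp. auto. }
  intros k Hk. unfold jump_factor. destruct (Nat.eq_dec k j) as [->|Hne].
  - unfold at_right, within. apply filter_forall. intros s Hs.
    destruct (Rlt_dec (tau j) s); [reflexivity|lra].
  - destruct (Rlt_dec (tau k) (tau j)) as [H|H].
    + unfold at_right, within. apply filter_forall. intros s Hs.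
      destruct (Rlt_dec (tau k) s); [reflexivity|lra].
    + assert (H' : tau j < tau k).
      { destruct (Req_dec (tau k) (tau j)) as [E|E]; [|lra].
        exfalso; apply Hne, tau_inj; auto. }
      unfold at_right, within. generalize (open_lt (tau k) (tau j) H'). apply filter_imp. intros s Hs _.
      destruct (Rlt_dec (tau k) s); [lra|reflexivity].
Qed.

Lemma jump_product_period (t : R) :
  0 <= t ->
  jump_product omega p tau bk (t + omega) =
    prod1 p (fun k => 1 + bk k) * jump_product omega p tau bk t.
Proof.
  intros Ht. set (b := impulse_bound omega p t).
  rewrite (jump_product_eq (p + b)), (jump_product_eq b), prod1_add.
  - f_equal; apply prod1_ext; intros k Hk; unfold jump_factor.
    + destruct (Rlt_dec (tau k) (t + omega)) as [H|H]; [reflexivity|].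
      assert (tau k <= tau p); [|lra].
      destruct (Nat.eq_dec k p) as [->|Hne]; [lra|].
      apply Rlt_le, tau_lt; lia.
    + rewrite tau_per, bk_per by lia.
      destruct (Rlt_dec (tau k + omega) (t + omega));
      destruct (Rlt_dec (tau k) t); try lra.
  - intros i Hi. apply tau_gt_bound in Hi. lra.
  - intros i Hi. replace i with ((i - p) + p)%nat by lia.
    rewrite tau_per by lia.
    assert (A := tau_gt_bound t (i - p) ltac:(unfold b in *; lia)). lra.
Qed.

Lemma jump_product_le (t : R) :
  t <= omega ->
  jump_product omega p tau bk t <= prod1 p (fun k => 1 + Rabs (bk k)).
Proof.
  intros Ht. rewrite (jump_product_eq p).
  - apply prod1_le. intros k Hk. split; [apply jump_factor_pos; lia|].
    unfold jump_factor. assert (A := Rle_abs (bk k)).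
    assert (B := Rabs_pos (bk k)).
    destruct (Rlt_dec (tau k) t); lra.
  - intros i Hi. assert (A := tau_gt_periods 1 i ltac:(lia)). simpl in A. lra.
Qed.

End Impulses.

(** * Calculus of left-hand derivatives *)

Lemma filterlim_Rmult (F : (R -> Prop) -> Prop) (FF : Filter F)
    (f g : R -> R) (x y : R) :
  filterlim f F (locally x) -> filterlim g F (locally y) ->
  filterlim (fun s => f s * g s) F (locally (x * y)).
Proof.
  intros Hf Hg. apply (filterlim_comp_2 f g Rmult Hf Hg).
  exact (filterlim_mult (K := R_AbsRing) x y).
Qed.

Lemma filterlim_Rplus (F : (R -> Prop) -> Prop) (FF : Filter F)
    (f g : R -> R) (x y : R) :
  filterlim f F (locally x) -> filterlim g F (locally y) ->
  filterlim (fun s => f s + g s) F (locally (x + y)).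
Proof.
  intros Hf Hg. apply (filterlim_comp_2 f g Rplus Hf Hg).
  exact (filterlim_plus (V := R_NormedModule) x y).
Qed.

Lemma is_derive_is_left_derive (f : R -> R) (t l : R) :
  is_derive f t l -> is_left_derive f t l.
Proof.
  intros H. apply is_derive_Reals in H.
  apply filterlim_locally. intros eps.
  destruct (H eps (cond_pos eps)) as [delta Hd].
  exists delta. intros s Hs Hst.
  unfold ball in *; simpl in *; unfold AbsRing_ball, abs, minus, plus, opp in *;
    simpl in *.
  specialize (Hd (s - t) ltac:(lra) Hs).
  replace (t + (s - t)) with s in Hd by ring. exact Hd.
Qed.

Lemma is_left_derive_ext_loc (f g : R -> R) (t l : R) :
  at_left t (fun s => f s = g s) -> f t = g t ->
  is_left_derive f t l -> is_left_derive g t l.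
Proof.
  intros Hfg Ht. apply filterlim_ext_loc.
  generalize Hfg. apply filter_imp. intros s Hs. rewrite Hs, Ht. reflexivity.
Qed.

Lemma is_left_derive_mult (f g : R -> R) (t lf lg : R) :
  is_left_derive f t lf -> is_left_derive g t lg -> continuous g t ->
  is_left_derive (fun s => g s * f s) t (g t * lf + lg * f t).
Proof.
  intros Hf Hg Hc.
  apply filterlim_ext_loc with
    (f := fun s => g s * ((f s - f t) / (s - t)) + (g s - g t) / (s - t) * f t).
  - unfold at_left, within. apply filter_forall. intros s Hs. field. lra.
  - apply filterlim_Rplus; [apply _| |]; apply filterlim_Rmult; try apply _;
      [|exact Hf|exact Hg|apply filterlim_const].
    apply filterlim_filter_le_1 with (2 := Hc). apply filter_le_within.
Qed.

Lemma is_left_derive_lin (f g : R -> R) (t lf lg x y : R) :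
  is_left_derive f t lf -> is_left_derive g t lg ->
  is_left_derive (fun s => x * f s + y * g s) t (x * lf + y * lg).
Proof.
  intros Hf Hg.
  apply filterlim_ext_loc with
    (f := fun s => x * ((f s - f t) / (s - t)) + y * ((g s - g t) / (s - t))).
  - unfold at_left, within. apply filter_forall. intros s Hs. field. lra.
  - apply filterlim_Rplus; [apply _| |]; apply filterlim_Rmult; try apply _;
      try apply filterlim_const; assumption.
Qed.

Lemma continuous_from_sides (f : R -> R) (t : R) :
  filterlim f (at_left t) (locally (f t)) ->
  filterlim f (at_right t) (locally (f t)) -> continuous f t.
Proof.
  intros Hl Hr. apply filterlim_locally. intros eps.
  assert (Al := proj1 (filterlim_locally _ _) Hl eps).
  assert (Ar := proj1 (filterlim_locally _ _) Hr eps).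
  unfold at_left, at_right, within in Al, Ar.
  generalize (filter_and _ _ Al Ar). apply filter_imp. intros s [H1 H2].
  destruct (Rtotal_order s t) as [H|[->|H]]; [auto|apply ball_center|auto].
Qed.

Lemma sum_n_m_lin_nonpos (A B : nat -> R) (x y : R) (n : nat) :
  (forall i, (1 <= i <= n)%nat -> x * A i + y * B i <= 0) ->
  x * sum_n_m A 1 n + y * sum_n_m B 1 n <= 0.
Proof.
  induction n as [|n IH]; intros H.
  - rewrite !sum_n_m_zero by lia. unfold zero; simpl. lra.
  - rewrite !sum_n_Sm by lia. unfold plus; simpl.
    specialize (H (S n) ltac:(lia)) as H1.
    assert (x * sum_n_m A 1 n + y * sum_n_m B 1 n <= 0)
      by (apply IH; intros; apply H; lia).
    lra.
Qed.

(** * The integrating factor and weighted solutions *)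

Section PositivePeriodicIntegral.

Variables (omega : R) (a : R -> R).
Hypothesis omega_pos : 0 < omega.
Hypothesis a_cont : forall t : R, continuous a t.
Hypothesis a_pos : forall t : R, 0 < a t.
Hypothesis a_per : periodic omega a.

Lemma ex_RInt_cont (x y : R) : ex_RInt a x y.
Proof. apply (ex_RInt_continuous (V := R_CompleteNormedModule)). auto. Qed.

Lemma RInt_is_derive (t : R) : is_derive (RInt a 0) t (a t).
Proof.
  apply is_derive_RInt with (a := 0); [|apply a_cont].
  apply filter_forall. intros s. apply RInt_correct, ex_RInt_cont.
Qed.

Lemma RInt_period (t : R) : RInt a 0 (t + omega) = RInt a 0 t + RInt a 0 omega.
Proof.
  rewrite <- (RInt_Chasles a 0 omega (t + omega)) by apply ex_RInt_cont.
  unfold plus; simpl. rewrite Rplus_comm. f_equal.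
  assert (H := RInt_comp_lin a 1 omega 0 t).
  replace (1 * 0 + omega) with omega in H by ring.
  replace (1 * t + omega) with (t + omega) in H by ring.
  rewrite <- H by apply ex_RInt_cont.
  apply RInt_ext. intros x _. unfold scal; simpl; unfold mult; simpl.
  rewrite !Rmult_1_l. apply a_per.
Qed.

Lemma RInt_nonneg (t : R) : 0 <= t -> 0 <= RInt a 0 t.
Proof.
  intros Ht. apply RInt_ge_0; [assumption|apply ex_RInt_cont|].
  intros; apply Rlt_le, a_pos.
Qed.

Lemma RInt_pos : 0 < RInt a 0 omega.
Proof. apply RInt_gt_0; auto. Qed.

End PositivePeriodicIntegral.

(** The integrating factor of [N' + a N = 0] with the jumps of the system:
    its inverse is the solution of that impulsive equation equal to 1 at
    time 0. *)
Definition weight (omega : R) (p : nat) (a : R -> R) (tau bk : nat -> R)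
    (t : R) : R :=
  exp (RInt a 0 t) / jump_product omega p tau bk t.

Section Lift.

Variables (omega : R) (n p : nat) (m : nat -> nat).
Variables (a : R -> R) (b beta : nat -> R -> R) (tau bk : nat -> R).
Hypothesis omega_pos : 0 < omega.
Hypothesis p_pos : (1 <= p)%nat.
Hypothesis a_cont : forall t : R, continuous a t.
Hypothesis a_pos : forall t : R, 0 < a t.
Hypothesis a_per : periodic omega a.
Hypothesis b_pos :
  forall i : nat, (1 <= i <= n)%nat -> forall t : R, 0 < b i t.
Hypothesis tau_first : 0 < tau 1%nat.
Hypothesis tau_incr : forall k : nat, (1 <= k < p)%nat -> tau k < tau (S k).
Hypothesis tau_last : tau p < omega.
Hypothesis tau_per :
  forall k : nat, (1 <= k)%nat -> tau (k + p)%nat = tau k + omega.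
Hypothesis bk_gt : forall k : nat, (1 <= k)%nat -> - 1 < bk k.
Hypothesis bk_per : forall k : nat, (1 <= k)%nat -> bk (k + p)%nat = bk k.

Let J := jump_product omega p tau bk.
Let w := weight omega p a tau bk.

Lemma weight_pos (t : R) : 0 < w t.
Proof.
  apply Rdiv_lt_0_compat; [apply exp_pos|].
  apply jump_product_pos; assumption.
Qed.

(** The factor [exp (- int a) * prod (1 + b_k)] is the multiplier of the
    homogeneous equation over one period. *)
Lemma weight_period (t : R) :
  0 <= t ->
  w t = exp (- RInt a 0 omega) * prod1 p (fun k => 1 + bk k) * w (t + omega).
Proof.
  intros Ht. unfold w, weight.
  rewrite jump_product_period, RInt_period by assumption.
  rewrite exp_plus, exp_Ropp.
  assert (A := exp_pos (RInt a 0 omega)).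
  assert (B : 0 < jump_product omega p tau bk t)
    by (apply jump_product_pos; assumption).
  assert (C : 0 < prod1 p (fun k => 1 + bk k)).
  { apply prod1_pos. intros j Hj. specialize (bk_gt j ltac:(lia)). lra. }
  field. lra.
Qed.

Lemma continuous_exp_RInt (t : R) : continuous (fun s => exp (RInt a 0 s)) t.
Proof.
  apply (continuous_comp (RInt a 0) exp); [|apply continuous_exp].
  apply (ex_derive_continuous (V := R_NormedModule)). exists (a t).
  apply RInt_is_derive; assumption.
Qed.

(** The limit is stated with the limit value [c] of the jump product, not
    with [w t], because the two differ on the right of an impulse. *)
Lemma weight_mult_filterlim (F : (R -> Prop) -> Prop) (FF : Filter F)
    (N : R -> R) (t c l : R) :
  filter_le F (locally t) -> filterlim N F (locally l) ->
  F (fun s => J s = c) ->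
  filterlim (fun s => w s * N s) F (locally (exp (RInt a 0 t) / c * l)).
Proof.
  intros HF HN HJ.
  apply filterlim_ext_loc with (f := fun s => exp (RInt a 0 s) * / c * N s).
  - generalize HJ. apply filter_imp. intros s <-. reflexivity.
  - apply filterlim_Rmult; [apply _| |exact HN].
    apply filterlim_Rmult; [apply _| |apply filterlim_const].
    apply filterlim_filter_le_1 with (1 := HF). apply continuous_exp_RInt.
Qed.

Lemma weighted_solution_continuous (N : R -> R) :
  is_solution omega n m a b beta tau bk N ->
  continuous_on (fun s => 0 <= s) (fun s => w s * N s).
Proof.
  intros HN t Ht.
  destruct (classic (impulse_time tau t)) as [[j [Hj ->]]|Hi].
  - apply filterlim_filter_le_1 with (1 := filter_le_within _).
    apply (continuous_from_sides (fun s => w s * N s)).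
    + apply (weight_mult_filterlim _ _ N (tau j) (J (tau j)) (N (tau j)));
        [apply filter_le_within| |].
      * apply (sol_left_continuous _ _ _ _ _ _ _ _ _ HN j Hj).
      * apply jump_product_at_left; assumption.
    + destruct (sol_jump _ _ _ _ _ _ _ _ _ HN j Hj) as [Np [HNp HE]].
      assert (B : 0 < jump_product omega p tau bk (tau j))
        by (apply jump_product_pos; assumption).
      specialize (bk_gt j Hj) as Hb.
      replace (w (tau j) * N (tau j)) with
        (exp (RInt a 0 (tau j)) / ((1 + bk j) * J (tau j)) * Np).
      * apply weight_mult_filterlim; [apply _|apply filter_le_within| |].
        { exact HNp. }
        { apply jump_product_at_right; assumption. }
      * replace Np with ((1 + bk j) * N (tau j)) by lra.
        unfold w, weight, J. field. lra.
  - apply (weight_mult_filterlim _ _ N t (J t) (N t));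
      [apply filter_le_within| |].
    + exact (sol_continuous _ _ _ _ _ _ _ _ _ HN t Ht Hi).
    + apply filter_le_within. apply jump_product_locally_constant; assumption.
Qed.

Lemma weighted_combination_continuous (N1 N2 : R -> R) (x y : R) :
  is_solution omega n m a b beta tau bk N1 ->
  is_solution omega n m a b beta tau bk N2 ->
  continuous_on (fun s => 0 <= s)
    (fun s => x * (w s * N1 s) + y * (w s * N2 s)).
Proof.
  intros H1 H2 t Ht.
  apply filterlim_Rplus; [apply _| |];
    (apply filterlim_Rmult; [apply _|apply filterlim_const|]);
    apply weighted_solution_continuous; assumption.
Qed.

Definition delayed_birth (N : R -> R) (t : R) (i : nat) : R :=
  b i t * exp (- beta i t * N (t - INR (m i) * omega)).

(** The weight absorbs the term [a N], so that only the birth terms remain. *)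
Lemma weighted_solution_derive (N : R -> R) (t : R) :
  is_solution omega n m a b beta tau bk N ->
  0 < t -> ~ impulse_time tau t ->
  is_left_derive (fun s => w s * N s) t
    (w t * sum_n_m (delayed_birth N t) 1 n).
Proof.
  intros HN Ht Hi.
  destruct (sol_equation _ _ _ _ _ _ _ _ _ HN t Ht Hi) as [dN [HdN HE]].
  apply is_left_derive_ext_loc with
    (f := fun s => exp (RInt a 0 s) * / J t * N s).
  - assert (A : locally t (fun s => J s = J t))
      by (apply jump_product_locally_constant; assumption).
    unfold at_left, within. generalize A. apply filter_imp. intros s Hs _.
    unfold w, weight, Rdiv. fold J. rewrite Hs. reflexivity.
  - reflexivity.
  - replace (w t * sum_n_m (delayed_birth N t) 1 n) with
      (exp (RInt a 0 t) * / J t * dN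
       + a t * exp (RInt a 0 t) * / J t * N t).
    + apply (is_left_derive_mult N (fun s => exp (RInt a 0 s) * / J t)).
      * exact HdN.
      * apply is_derive_is_left_derive.
        assert (A : is_derive (RInt a 0) t (a t))
          by (apply RInt_is_derive; assumption).
        revert A. generalize (RInt a 0) as g. intros g A.
        auto_derive; [exists (a t); exact A|].
        replace (Derive (fun s => g s) t) with (a t);
          [ring|symmetry; apply is_derive_unique, A].
      * apply (continuous_mult (fun s => exp (RInt a 0 s))).
        { apply continuous_exp_RInt. }
        { apply continuous_const. }
    + unfold delayed_birth. rewrite <- HE. unfold w, weight.
      fold J. unfold Rdiv. ring.
Qed.

(** All differential inequalities of the proof are of this form: a linear
    combination of two weighted solutions has the same linear combination of
    the birth terms as its derivative, so that its monotonicity is decided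
    term by term.  The condition is on the exponentials only, since
    the positive coefficients [b_i] factor out. *)
Lemma weighted_combination_nonincreasing (N1 N2 : R -> R) (x y c d : R) :
  is_solution omega n m a b beta tau bk N1 ->
  is_solution omega n m a b beta tau bk N2 ->
  0 <= c <= d ->
  (forall t i, c < t < d -> (1 <= i <= n)%nat ->
     x * exp (- beta i t * N1 (t - INR (m i) * omega)) +
     y * exp (- beta i t * N2 (t - INR (m i) * omega)) <= 0) ->
  x * (w d * N1 d) + y * (w d * N2 d) <= x * (w c * N1 c) + y * (w c * N2 c).
Proof.
  intros H1 H2 Hcd H.
  apply (left_derive_nonincreasing_except
           (map tau (seq 1 (impulse_bound omega p d)))
           (fun s => x * (w s * N1 s) + y * (w s * N2 s))); [lra| |].
  - apply continuous_on_subset with (fun s => 0 <= s); [intros; lra|].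
    apply weighted_combination_continuous; assumption.
  - intros t Ht Hn.
    apply impulse_times_finite in Hn; try assumption; [|lra].
    eexists. split.
    + apply is_left_derive_lin; apply weighted_solution_derive; auto; lra.
    + assert (A := weight_pos t).
      assert (B := sum_n_m_lin_nonpos (delayed_birth N1 t)
                     (delayed_birth N2 t) x y n).
      assert (x * sum_n_m (delayed_birth N1 t) 1 n +
              y * sum_n_m (delayed_birth N2 t) 1 n <= 0); [|nra].
      apply B. intros i Hi. unfold delayed_birth.
      specialize (H t i Ht Hi). specialize (b_pos i Hi t). nra.
Qed.

End Lift.

(** * Elementary estimates *)

Lemma exp_nondecreasing (x y : R) : x <= y -> exp x <= exp y.
Proof.
  intros [H| ->]; [apply Rlt_le, exp_increasing, H|apply Rle_refl].
Qed.

(** Convexity: combine the tangent bounds of [exp] at [l * M], taken at [M]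
    and at [0], with weights [l] and [1 - l]. *)
Lemma exp_chord (M l : R) :
  0 <= l <= 1 -> exp (l * M) <= 1 + l * (exp M - 1).
Proof.
  intros Hl.
  assert (A := exp_ineq1_le (M - l * M)). assert (B := exp_ineq1_le (- (l * M))).
  assert (C := exp_pos (l * M)).
  assert (A' : exp M = exp (l * M) * exp (M - l * M))
    by (rewrite <- exp_plus; f_equal; ring).
  assert (B' : 1 = exp (l * M) * exp (- (l * M)))
    by (rewrite <- exp_plus, Rplus_opp_r, exp_0; reflexivity).
  assert (A2 : exp (l * M) * (1 + (M - l * M)) <= exp M) by nra.
  assert (B2 : exp (l * M) * (1 + - (l * M)) <= 1) by nra.
  nra.
Qed.

(** With [y = N1 / N2 - 1], the ratio of the exponentials is
    [exp (- be * N2 * y)]; the chord bound is what makes the factor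
    [exp M - 1] of [sigma ^ 2] appear. *)
Lemma exp_opp_le_chord (be N1 N2 l M : R) :
  0 < be -> 0 <= l <= 1 -> be * N2 <= M -> (1 - l) * N2 <= N1 ->
  exp (- be * N1) <= (1 + l * (exp M - 1)) * exp (- be * N2).
Proof.
  intros Hbe Hl HM HN.
  apply Rle_trans with (exp (l * M) * exp (- be * N2)).
  - rewrite <- exp_plus. apply exp_nondecreasing.
    assert (be * ((1 - l) * N2) <= be * N1) by (apply Rmult_le_compat_l; lra).
    assert (l * (be * N2) <= l * M) by (apply Rmult_le_compat_l; lra).
    lra.
  - apply Rmult_le_compat_r; [apply Rlt_le, exp_pos|apply exp_chord, Hl].
Qed.

(** The counterpart for positive deviations, where the tangent at 0 gives the
    other factor [M] of [sigma ^ 2]. *)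
Lemma exp_opp_ge_tangent (be N1 N2 L M : R) :
  0 < be -> 0 <= L -> be * N2 <= M -> N1 <= (1 + L) * N2 ->
  (1 - M * L) * exp (- be * N2) <= exp (- be * N1).
Proof.
  intros Hbe HL HM HN.
  apply Rle_trans with (exp (- (M * L)) * exp (- be * N2)).
  - apply Rmult_le_compat_r; [apply Rlt_le, exp_pos|].
    assert (A := exp_ineq1_le (- (M * L))). lra.
  - rewrite <- exp_plus. apply exp_nondecreasing.
    assert (be * N1 <= be * ((1 + L) * N2)) by (apply Rmult_le_compat_l; lra).
    assert (L * (be * N2) <= L * M) by (apply Rmult_le_compat_l; lra).
    lra.
Qed.

Lemma forall_nonneg_by_period (omega : R) (Q : R -> Prop) :
  0 < omega -> (forall t, 0 <= t <= omega -> Q t) ->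
  (forall t, 0 <= t -> Q t -> Q (t + omega)) -> forall t, 0 <= t -> Q t.
Proof.
  intros Ho Hb Hs.
  assert (A : forall k t, 0 <= t <= INR (S k) * omega -> Q t).
  { induction k as [|k IH]; intros t Ht.
    - apply Hb. simpl in Ht. lra.
    - destruct (Rle_dec t omega) as [H|H]; [apply Hb; lra|].
      replace t with (t - omega + omega) by ring.
      apply Hs; [lra|]. apply IH. rewrite S_INR in Ht. lra. }
  intros t Ht.
  destruct (archimed (t / omega)) as [B _].
  apply (A (Z.to_nat (up (t / omega)))).
  assert (IZR (up (t / omega)) <= INR (Z.to_nat (up (t / omega)))).
  { rewrite INR_IZR_INZ. apply IZR_le. lia. }
  rewrite S_INR. split; [assumption|].
  replace t with (t / omega * omega) at 1 by (field; lra).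
  apply Rmult_le_compat_r; lra.
Qed.

Lemma periodic_sub_INR (omega : R) (f : R -> R) (k : nat) (t : R) :
  periodic omega f -> f (t - INR k * omega) = f t.
Proof.
  intros Hf. induction k as [|k IH].
  - simpl. f_equal. ring.
  - rewrite <- IH, <- (Hf (t - INR (S k) * omega)), S_INR. f_equal. ring.
Qed.

Lemma finite_family_bounded (n : nat) (f : nat -> R -> R) (x y : R) :
  x <= y -> (forall i, (1 <= i <= n)%nat -> forall t, continuous (f i) t) ->
  exists C, 0 <= C /\
    forall i t, (1 <= i <= n)%nat -> x <= t <= y -> f i t <= C.
Proof.
  intros Hxy. induction n as [|n IH]; intros Hf.
  - exists 0. split; [lra|]. intros; lia.
  - destruct IH as [C [HC HCb]]; [intros; apply Hf; lia|].
    destruct (continuity_ab_maj (f (S n)) x y Hxy) as [z [Hz _]].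
    { intros t _. apply continuity_pt_filterlim, Hf. lia. }
    exists (Rmax C (f (S n) z)). split.
    { apply Rle_trans with (1 := HC), Rmax_l. }
    intros i t Hi Ht. destruct (Nat.eq_dec i (S n)) as [->|Hne].
    + apply Rle_trans with (2 := Rmax_r _ _). auto.
    + apply Rle_trans with (2 := Rmax_l _ _). apply HCb; [lia|assumption].
Qed.

Lemma mbar_ge (n : nat) (m : nat -> nat) (i : nat) :
  (1 <= i <= n)%nat -> (m i <= mbar n m)%nat.
Proof.
  intros Hi. unfold mbar.
  assert (A := proj1 (list_max_le (map m (seq 1 n)) _) (le_n _)).
  rewrite Forall_forall in A. apply A, in_map, in_seq. lia.
Qed.

(** * Attraction to the periodic solution *)

Section Attractivity.

Variables (omega : R) (n p : nat) (m : nat -> nat).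
Variables (a : R -> R) (b beta : nat -> R -> R) (tau bk : nat -> R).
Variable Nstar : R -> R.
Hypothesis omega_pos : 0 < omega.
Hypothesis n_pos : (1 <= n)%nat.
Hypothesis p_pos : (1 <= p)%nat.
Hypothesis m_pos : forall i : nat, (1 <= i <= n)%nat -> (1 <= m i)%nat.
Hypothesis a_cont : forall t : R, continuous a t.
Hypothesis a_pos : forall t : R, 0 < a t.
Hypothesis a_per : periodic omega a.
Hypothesis b_pos :
  forall i : nat, (1 <= i <= n)%nat -> forall t : R, 0 < b i t.
Hypothesis beta_cont : forall i : nat, (1 <= i <= n)%nat ->
  forall t : R, continuous (beta i) t.
Hypothesis beta_pos : forall i : nat, (1 <= i <= n)%nat ->
  forall t : R, 0 < beta i t.
Hypothesis beta_per :
  forall i : nat, (1 <= i <= n)%nat -> periodic omega (beta i).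
Hypothesis tau_first : 0 < tau 1%nat.
Hypothesis tau_incr : forall k : nat, (1 <= k < p)%nat -> tau k < tau (S k).
Hypothesis tau_last : tau p < omega.
Hypothesis tau_per :
  forall k : nat, (1 <= k)%nat -> tau (k + p)%nat = tau k + omega.
Hypothesis bk_gt : forall k : nat, (1 <= k)%nat -> - 1 < bk k.
Hypothesis bk_per : forall k : nat, (1 <= k)%nat -> bk (k + p)%nat = bk k.
Hypothesis bk_prod : prod1 p (fun k => 1 + bk k) <= 1.
Hypothesis Nstar_sol :
  is_periodic_positive_solution omega n m a b beta tau bk Nstar.

Let w := weight omega p a tau bk.
Let M := beta_sup omega n beta Nstar.
Let rho := exp (- RInt a 0 omega) * prod1 p (fun k => 1 + bk k).
Let kappa := rho ^ mbar n m.
Let delay := INR (mbar n m) * omega.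

Lemma mbar_pos : (1 <= mbar n m)%nat.
Proof.
  apply Nat.le_trans with (m 1%nat); [apply m_pos|apply mbar_ge]; lia.
Qed.

Lemma delay_pos : 0 < delay.
Proof.
  assert (A := mbar_pos). apply le_INR in A. simpl in A.
  apply Rmult_lt_0_compat; lra.
Qed.

Lemma delay_ge (i : nat) :
  (1 <= i <= n)%nat -> INR (m i) * omega <= delay.
Proof.
  intros Hi. apply Rmult_le_compat_r; [lra|]. apply le_INR, mbar_ge, Hi.
Qed.

Lemma rho_range : 0 < rho < 1.
Proof.
  assert (A : 0 < prod1 p (fun k => 1 + bk k)).
  { apply prod1_pos. intros j Hj. specialize (bk_gt j ltac:(lia)). lra. }
  assert (B := exp_pos (- RInt a 0 omega)).
  assert (C : exp (- RInt a 0 omega) < 1).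
  { rewrite <- exp_0. apply exp_increasing.
    assert (0 < RInt a 0 omega) by (apply RInt_pos; assumption). lra. }
  split; [apply Rmult_lt_0_compat; assumption|]. unfold rho. nra.
Qed.

Lemma kappa_range : 0 < kappa < 1.
Proof.
  assert (A := rho_range). assert (B := mbar_pos). unfold kappa.
  split; [apply pow_lt; lra|].
  destruct (mbar n m) as [|k]; [lia|]. simpl.
  assert (C : 0 < rho ^ k <= 1).
  { split; [apply pow_lt; lra|]. rewrite <- (pow1 k). apply pow_incr. lra. }
  nra.
Qed.

Lemma Nstar_pos (t : R) : 0 <= t -> 0 < Nstar t.
Proof.
  intros Ht. apply (proj2 Nstar_sol). assert (A := delay_pos).
  unfold delay in A. lra.
Qed.

Lemma Nstar_per (t : R) : 0 <= t -> Nstar (t + omega) = Nstar t.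
Proof.
  intros Ht. apply (proj2 Nstar_sol). assert (A := delay_pos).
  unfold delay in A. lra.
Qed.

Lemma w_pos (t : R) : 0 < w t.
Proof. apply weight_pos; assumption. Qed.

(** Up to a constant, [w * Nstar] is the exponential of the integral of
    [B / Nstar], where [B] is the total birth rate of [Nstar]; in this sense
    it is the exponential of the natural time of the equation satisfied by
    [N / Nstar - 1]. *)
Lemma clock_nondecreasing (s t : R) :
  0 <= s <= t -> w s * Nstar s <= w t * Nstar t.
Proof.
  intros Hst.
  assert (A : 0 * (w t * Nstar t) + -1 * (w t * Nstar t) <=
              0 * (w s * Nstar s) + -1 * (w s * Nstar s)); [|lra].
  apply (weighted_combination_nonincreasing omega n p m a b beta tau bk);
    try assumption; try apply Nstar_sol.
  intros u i Hu Hi.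
  assert (B := exp_pos (- beta i u * Nstar (u - INR (m i) * omega))). lra.
Qed.

Lemma clock_period (k : nat) (t : R) :
  0 <= t ->
  w t * Nstar t =
    rho ^ k * (w (t + INR k * omega) * Nstar (t + INR k * omega)).
Proof.
  intros Ht. induction k as [|k IH].
  - simpl. rewrite Rmult_0_l, Rplus_0_r. ring.
  - rewrite IH, S_INR.
    replace (t + (INR k + 1) * omega) with (t + INR k * omega + omega) by ring.
    assert (A : 0 <= INR k * omega)
      by (apply Rmult_le_pos; [apply pos_INR|lra]).
    rewrite Nstar_per by lra.
    assert (B : w (t + INR k * omega) = rho * w (t + INR k * omega + omega))
      by (apply weight_period; try assumption; lra).
    rewrite B. simpl. ring.
Qed.

(** On one period, [Nstar] is the increasing clock times the jump product,
    divided by a quantity at least 1; this avoids a compactness argument for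
    piecewise continuous functions. *)
Lemma Nstar_bounded : exists B, 0 < B /\ forall t, 0 <= t -> Nstar t <= B.
Proof.
  exists (w omega * Nstar omega * prod1 p (fun k => 1 + Rabs (bk k))).
  assert (HJ : 0 < prod1 p (fun k => 1 + Rabs (bk k))).
  { apply prod1_pos. intros j _. assert (A := Rabs_pos (bk j)). lra. }
  assert (Hw := w_pos omega). assert (HN := Nstar_pos omega ltac:(lra)).
  split; [apply Rmult_lt_0_compat; [apply Rmult_lt_0_compat|]; assumption|].
  apply forall_nonneg_by_period with omega; [assumption| |].
  - intros t Ht.
    assert (A := clock_nondecreasing t omega Ht).
    assert (B : jump_product omega p tau bk t <=
                prod1 p (fun k => 1 + Rabs (bk k)))
      by (apply jump_product_le; try assumption; lra).
    assert (C : 0 < jump_product omega p tau bk t)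
      by (apply jump_product_pos; assumption).
    assert (I : 1 <= exp (RInt a 0 t)).
    { assert (0 <= RInt a 0 t) by (apply RInt_nonneg; try assumption; lra).
      assert (D := exp_ineq1_le (RInt a 0 t)). lra. }
    assert (HNt := Nstar_pos t ltac:(lra)).
    assert (E : Nstar t <= w t * Nstar t * jump_product omega p tau bk t).
    { unfold w, weight.
      replace (exp (RInt a 0 t) / jump_product omega p tau bk t * Nstar t *
               jump_product omega p tau bk t)
        with (exp (RInt a 0 t) * Nstar t) by (field; lra). nra. }
    apply Rle_trans with (1 := E).
    assert (0 < w t * Nstar t) by (apply Rmult_lt_0_compat; [apply w_pos|auto]).
    apply Rmult_le_compat; lra.
  - intros t Ht H. rewrite Nstar_per; assumption.
Qed.

(** The real part of an infinite supremum would be 0, so boundedness of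
    [Nstar] has to be used here. *)
Lemma beta_Nstar_le (i : nat) (t : R) :
  (1 <= i <= n)%nat -> 0 <= t -> beta i t * Nstar t <= M.
Proof.
  intros Hi. revert t. apply forall_nonneg_by_period with omega; [assumption| |].
  2: { intros t Ht H. rewrite Nstar_per, (beta_per i Hi); assumption. }
  intros t Ht. unfold M, beta_sup.
  match goal with |- context [Lub_Rbar ?S] =>
    destruct (Lub_Rbar_correct S) as [Hub Hlub];
    assert (HS : S (beta i t * Nstar t)) by (exists t, i; auto);
    set (Sset := S) in *
  end.
  destruct Nstar_bounded as [B [HB HNB]].
  destruct (finite_family_bounded n beta 0 omega ltac:(lra) beta_cont)
    as [C [HC HCb]].
  assert (Hfin : Rbar_le (Lub_Rbar Sset) (Finite (C * B))).
  { apply Hlub. intros x [u [j [Hu [Hj ->]]]]. simpl.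
    apply Rmult_le_compat; auto.
    - apply Rlt_le, beta_pos, Hj.
    - apply Rlt_le, Nstar_pos; lra.
    - apply HNB; lra. }
  specialize (Hub _ HS).
  destruct (Lub_Rbar Sset) as [x| |]; simpl in *; [assumption|tauto|tauto].
Qed.

Lemma M_pos : 0 < M.
Proof.
  apply Rlt_le_trans with (beta 1%nat 0 * Nstar 0).
  - apply Rmult_lt_0_compat; [apply beta_pos; lia|apply Nstar_pos; lra].
  - apply beta_Nstar_le; [lia|lra].
Qed.

Lemma beta_Nstar_delayed_le (i : nat) (t : R) :
  (1 <= i <= n)%nat -> 0 <= t - INR (m i) * omega ->
  beta i t * Nstar (t - INR (m i) * omega) <= M.
Proof.
  intros Hi Ht. rewrite <- (periodic_sub_INR omega (beta i) (m i) t); auto.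
  apply beta_Nstar_le; assumption.
Qed.

Variable N : R -> R.
Hypothesis N_sol : is_positive_solution omega n m a b beta tau bk N.

Lemma positive_solution_nonneg (t : R) : 0 <= t -> 0 <= N t.
Proof.
  intros Ht.
  destruct N_sol as [HN [phi [_ [_ [Hphi0 Hphi]]]]].
  assert (H0 : N 0 = phi 0).
  { apply Hphi. assert (A := delay_pos). unfold delay in A. lra. }
  assert (A : -1 * (w t * N t) + 0 * (w t * N t) <=
              -1 * (w 0 * N 0) + 0 * (w 0 * N 0)).
  { apply (weighted_combination_nonincreasing omega n p m a b beta tau bk);
      try assumption; [lra|].
    intros u i Hu Hi.
    assert (B := exp_pos (- beta i u * N (u - INR (m i) * omega))). lra. }
  assert (B := w_pos 0). assert (C := w_pos t).
  assert (0 < w 0 * N 0) by (apply Rmult_lt_0_compat; lra). nra.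
Qed.

(** Both halves of the oscillation argument, above [Nstar] for [x = 1] and
    below it for [x = -1].  The first condition says that, in the time
    scale given by the clock, the deviation [x * (N / Nstar - 1)] grows at
    most like the solution of [z' = P - z]; the second one is the negative
    feedback: a nonnegative deviation over a whole delay window does not
    produce growth of [x * w * (N - Nstar)]. *)
Lemma one_sided_bound (x P T : R) :
  0 < P -> 0 <= T ->
  (forall t i, (1 <= i <= n)%nat -> T <= t - INR (m i) * omega ->
     x * exp (- beta i t * N (t - INR (m i) * omega)) +
     (- x - P) * exp (- beta i t * Nstar (t - INR (m i) * omega)) <= 0) ->
  (forall t i, (1 <= i <= n)%nat -> T <= t - INR (m i) * omega ->
     0 <= x * (N (t - INR (m i) * omega) - Nstar (t - INR (m i) * omega)) ->
     x * exp (- beta i t * N (t - INR (m i) * omega)) +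
     - x * exp (- beta i t * Nstar (t - INR (m i) * omega)) <= 0) ->
  exists T', 0 <= T' /\
    forall t, T' <= t -> x * (N t - Nstar t) <= (1 - kappa) * P * Nstar t.
Proof.
  intros HP HT H1 H2.
  assert (Hd := delay_pos).
  destruct (eventually_bounded_above (fun t => w t * Nstar t)
    (fun t => x * (w t * N t) + - x * (w t * Nstar t))
    delay kappa P (T + delay)) as [T' [HT' HTb]].
  - exact Hd.
  - exact kappa_range.
  - exact HP.
  - lra.
  - intros t Ht. apply Rmult_lt_0_compat; [apply w_pos|apply Nstar_pos, Ht].
  - exact clock_nondecreasing.
  - intros t Ht. apply clock_period, Ht.
  - apply (weighted_combination_continuous omega n p m a b beta tau bk);
      try assumption; [apply N_sol|apply Nstar_sol].
  - intros s t Hst.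
    assert (A : x * (w t * N t) + (- x - P) * (w t * Nstar t) <=
                x * (w s * N s) + (- x - P) * (w s * Nstar s)); [|lra].
    apply (weighted_combination_nonincreasing omega n p m a b beta tau bk);
      try assumption; [apply N_sol|apply Nstar_sol|lra|].
    intros u i Hu Hi. assert (B := delay_ge i Hi). apply H1; [assumption|lra].
  - intros s t Hst Hpos.
    apply (weighted_combination_nonincreasing omega n p m a b beta tau bk);
      try assumption; [apply N_sol|apply Nstar_sol|lra|].
    intros u i Hu Hi. assert (B := delay_ge i Hi).
    assert (0 < INR (m i) * omega).
    { apply Rmult_lt_0_compat; [apply lt_0_INR|assumption].
      specialize (m_pos i Hi). lia. }
    apply H2; [assumption|lra|].
    specialize (Hpos (u - INR (m i) * omega) ltac:(lra)).
    assert (C := w_pos (u - INR (m i) * omega)). nra.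
  - exists T'. split; [assumption|]. intros t Ht. specialize (HTb t Ht).
    simpl in HTb. apply Rmult_le_reg_l with (w t); [apply w_pos|]. lra.
Qed.

(** A population at most a fraction [l] below [Nstar] lowers the exponents
    by at most [l * M], so births exceed those of [Nstar] by a factor at
    most [1 + l * (exp M - 1)]. *)
Lemma upper_from_lower (l T : R) :
  0 < l <= 1 -> 0 <= T ->
  (forall t, T <= t -> (1 - l) * Nstar t <= N t) ->
  exists T', 0 <= T' /\ forall t, T' <= t ->
    N t <= (1 + (1 - kappa) * (l * (exp M - 1))) * Nstar t.
Proof.
  intros Hl HT Hlow.
  destruct (one_sided_bound 1 (l * (exp M - 1)) T) as [T' [HT' H]].
  - apply Rmult_lt_0_compat; [lra|].
    assert (A := exp_ineq1_le M). assert (B := M_pos). lra.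
  - exact HT.
  - intros t i Hi Ht.
    assert (A := exp_opp_le_chord (beta i t) (N (t - INR (m i) * omega))
      (Nstar (t - INR (m i) * omega)) l M (beta_pos i Hi t) ltac:(lra)
      (beta_Nstar_delayed_le i t Hi ltac:(lra)) (Hlow _ Ht)).
    lra.
  - intros t i Hi Ht Hpos.
    assert (A := exp_opp_le_chord (beta i t) (N (t - INR (m i) * omega))
      (Nstar (t - INR (m i) * omega)) 0 M (beta_pos i Hi t) ltac:(lra)
      (beta_Nstar_delayed_le i t Hi ltac:(lra)) ltac:(lra)).
    lra.
  - exists T'. split; [assumption|]. intros t Ht. specialize (H t Ht). lra.
Qed.

(** A population at most a fraction [L] above [Nstar] reduces the births by
    a fraction at most [M * L]. *)
Lemma lower_from_upper (L T : R) :
  0 < L -> 0 <= T ->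
  (forall t, T <= t -> N t <= (1 + L) * Nstar t) ->
  exists T', 0 <= T' /\ forall t, T' <= t ->
    (1 - (1 - kappa) * (M * L)) * Nstar t <= N t.
Proof.
  intros HL HT Hup.
  destruct (one_sided_bound (-1) (M * L) T) as [T' [HT' H]].
  - apply Rmult_lt_0_compat; [exact M_pos|lra].
  - exact HT.
  - intros t i Hi Ht.
    assert (A := exp_opp_ge_tangent (beta i t) (N (t - INR (m i) * omega))
      (Nstar (t - INR (m i) * omega)) L M (beta_pos i Hi t) ltac:(lra)
      (beta_Nstar_delayed_le i t Hi ltac:(lra)) (Hup _ Ht)).
    lra.
  - intros t i Hi Ht Hneg.
    assert (A := exp_opp_ge_tangent (beta i t) (N (t - INR (m i) * omega))
      (Nstar (t - INR (m i) * omega)) 0 M (beta_pos i Hi t) ltac:(lra)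
      (beta_Nstar_delayed_le i t Hi ltac:(lra)) ltac:(lra)).
    lra.
  - exists T'. split; [assumption|]. intros t Ht. specialize (H t Ht). lra.
Qed.

(** The square of [sigma], the gain of one round trip from a lower bound to
    an upper bound and back. *)
Let contraction := (1 - kappa) * (1 - kappa) * (M * (exp M - 1)).

Lemma contraction_pos : 0 < contraction.
Proof.
  assert (A := kappa_range). assert (B := M_pos). assert (C := exp_ineq1_le M).
  unfold contraction. repeat apply Rmult_lt_0_compat; lra.
Qed.

Lemma contraction_lt_1 :
  sigma_const omega n p m a beta bk Nstar < 1 -> contraction < 1.
Proof.
  unfold sigma_const. fold M rho kappa. cbv zeta. intros Hs.
  assert (A := kappa_range). assert (B := M_pos). assert (C := exp_ineq1_le M).
  assert (D : 0 <= M * (exp M - 1)) by (apply Rmult_le_pos; lra).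
  assert (E := sqrt_sqrt _ D). assert (F := sqrt_pos (M * (exp M - 1))).
  unfold contraction. rewrite <- E.
  set (q := sqrt (M * (exp M - 1))) in *.
  assert (0 <= q * (1 - kappa)) by (apply Rmult_le_pos; lra).
  nra.
Qed.

(** The iteration starts from [0 <= N], which is the lower bound with
    [l = 1]. *)
Lemma eventually_close_below (k : nat) :
  contraction < 1 ->
  exists T, 0 <= T /\
    forall t, T <= t -> (1 - contraction ^ k) * Nstar t <= N t.
Proof.
  intros Hc. assert (Hc0 := contraction_pos).
  induction k as [|k [T [HT IH]]].
  - exists 0. split; [lra|]. intros t Ht. simpl.
    assert (A := positive_solution_nonneg t Ht). lra.
  - assert (Hk : 0 < contraction ^ k <= 1).
    { split; [apply pow_lt, Hc0|]. rewrite <- (pow1 k). apply pow_incr. lra. }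
    destruct (upper_from_lower _ T Hk HT IH) as [T1 [HT1 H1]].
    assert (A := kappa_range). assert (B := M_pos).
    assert (C := exp_ineq1_le M).
    assert (HL : 0 < (1 - kappa) * (contraction ^ k * (exp M - 1))).
    { apply Rmult_lt_0_compat; [lra|]. apply Rmult_lt_0_compat; lra. }
    destruct (lower_from_upper _ T1 HL HT1 H1) as [T2 [HT2 H2]].
    exists T2. split; [assumption|]. intros t Ht.
    replace (contraction ^ S k) with
      ((1 - kappa) * (M * ((1 - kappa) * (contraction ^ k * (exp M - 1))))).
    + apply H2, Ht.
    + rewrite <- tech_pow_Rmult. generalize (contraction ^ k). intro x.
      unfold contraction. ring.
Qed.

Lemma positive_solution_attracted :
  sigma_const omega n p m a beta bk Nstar < 1 ->
  is_lim (fun t => N t - Nstar t) p_infty 0.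
Proof.
  intros Hs. assert (Hc := contraction_lt_1 Hs). assert (Hc0 := contraction_pos).
  assert (A := kappa_range). assert (B := M_pos). assert (C := exp_ineq1_le M).
  destruct Nstar_bounded as [Bd [HBd HNB]].
  apply is_lim_spec. intros eps.
  set (Q := 1 + (1 - kappa) * (exp M - 1)).
  assert (HQ : 1 < Q).
  { assert (0 < (1 - kappa) * (exp M - 1)) by (apply Rmult_lt_0_compat; lra).
    unfold Q; lra. }
  assert (He : 0 < eps / (Q * Bd)).
  { apply Rdiv_lt_0_compat; [apply cond_pos|apply Rmult_lt_0_compat; lra]. }
  destruct (pow_lt_1_zero contraction ltac:(apply Rabs_def1; lra) _ He)
    as [k Hk].
  specialize (Hk k (le_n k)).
  assert (Hk0 : 0 < contraction ^ k <= 1).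
  { split; [apply pow_lt, Hc0|]. rewrite <- (pow1 k). apply pow_incr. lra. }
  rewrite Rabs_pos_eq in Hk by lra.
  destruct (eventually_close_below k Hc) as [T [HT Hlow]].
  destruct (upper_from_lower _ T Hk0 HT Hlow) as [T' [HT' Hup]].
  exists (Rmax T T'). intros t Ht.
  assert (Ht1 := Rmax_l T T'). assert (Ht2 := Rmax_r T T').
  specialize (Hlow t ltac:(lra)). specialize (Hup t ltac:(lra)).
  assert (HN := Nstar_pos t ltac:(lra)). specialize (HNB t ltac:(lra)).
  set (x := contraction ^ k) in *.
  assert (Hx : x * (Q * Bd) < eps).
  { apply Rmult_lt_compat_r with (r := Q * Bd) in Hk;
      [|apply Rmult_lt_0_compat; lra].
    replace (eps / (Q * Bd) * (Q * Bd)) with (pos eps) in Hk by (field; lra).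
    exact Hk. }
  assert (HxN : x * Q * Nstar t <= x * Q * Bd).
  { apply Rmult_le_compat_l; [apply Rmult_le_pos; lra|assumption]. }
  assert (H1 : 0 < x * Nstar t) by (apply Rmult_lt_0_compat; lra).
  assert (H2 : x * Nstar t <= x * Q * Nstar t) by nra.
  assert (H3 : 0 <= x * (1 - kappa) * (exp M - 1) * Nstar t)
    by (repeat apply Rmult_le_pos; lra).
  rewrite Rminus_0_r. apply Rabs_def1; unfold Q in *; lra.
Qed.

End Attractivity.

Theorem theorem3p6 (omega : R) (n p : nat) (m : nat -> nat)
    (a : R -> R) (b beta : nat -> R -> R) (tau bk : nat -> R)
    (Nstar : R -> R)
    (omega_pos : 0 < omega)
    (n_pos : (1 <= n)%nat)
    (p_pos : (1 <= p)%nat)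
    (m_pos : forall i : nat, (1 <= i <= n)%nat -> (1 <= m i)%nat)
    (a_cont : forall t : R, continuous a t)
    (a_pos : forall t : R, 0 < a t)
    (a_per : periodic omega a)
    (b_cont : forall i : nat, (1 <= i <= n)%nat ->
       forall t : R, continuous (b i) t)
    (b_pos : forall i : nat, (1 <= i <= n)%nat -> forall t : R, 0 < b i t)
    (b_per : forall i : nat, (1 <= i <= n)%nat -> periodic omega (b i))
    (beta_cont : forall i : nat, (1 <= i <= n)%nat ->
       forall t : R, continuous (beta i) t)
    (beta_pos : forall i : nat, (1 <= i <= n)%nat ->
       forall t : R, 0 < beta i t)
    (beta_per : forall i : nat, (1 <= i <= n)%nat -> periodic omega (beta i))
    (tau_first : 0 < tau 1%nat)
    (tau_incr : forall k : nat, (1 <= k < p)%nat -> tau k < tau (S k))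
    (tau_last : tau p < omega)
    (tau_lim : is_lim_seq tau p_infty)
    (tau_per : forall k : nat, (1 <= k)%nat -> tau (k + p)%nat = tau k + omega)
    (bk_gt : forall k : nat, (1 <= k)%nat -> - 1 < bk k)
    (bk_per : forall k : nat, (1 <= k)%nat -> bk (k + p)%nat = bk k)
    (bk_prod : prod1 p (fun k => 1 + bk k) <= 1)
    (Nstar_sol :
       is_periodic_positive_solution omega n m a b beta tau bk Nstar)
    (sigma_lt : sigma_const omega n p m a beta bk Nstar < 1) :
  forall N : R -> R,
    is_positive_solution omega n m a b beta tau bk N ->
    is_lim (fun t => N t - Nstar t) p_infty 0.
Proof.
  intros N HN.
  apply (positive_solution_attracted omega n p m a b beta tau bk Nstar);
    assumption.
Qed.
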